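(* Let $p,q$ be co-prime integers with $0<p<q$, and write $$\frac{p}{q}=[0;1+d_1,d_2,\dots,d_n,1]$$ with $n\ge 1$, $d_1\ge 0$ and $d_i\ge 1$ for $2\le i\le n$. Let $w$ be the Christoffel word of slope $p/q$ beginning with the letter $a$ (over the alphabet $\{a,b\}$ with $a<b$). Then the number $\mathcal{L}(w)$ of distinct Lyndon factors of $w$ is $$\mathcal{L}(w)=d_1+d_2+\cdots+d_n+3.$$
   Context: $[0;c_1,c_2,\dots,c_k]$ denotes the simple continued fraction $\cfrac{1}{c_1+\cfrac{1}{c_2+\cdots+\cfrac{1}{c_k}}}$. Words over $\{a,b\}$ are compared by the lexicographic order with $a<b$. A word $z$ is a factor of $w$ if $w=uzv$ for some (possibly empty) words $u,v$ (so $w$ is a factor of itself). A word is primitive if it is non-empty and is not a power $x^k$, $k\ge 2$, of a shorter word. Two words $u,v$ are conjugate if $u=xy$, $v=yx$ for some words $x,y$. A Lyndon word is a non-empty primitive word that is lexicographically least in its conjugacy class (equivalently, a non-empty word that is a single letter or is strictly smaller than each of its non-empty proper suffixes). $\mathcal{L}(w)$ denotes the number of distinct words that are Lyndon words and factors of $w$. For a word $u$, $u^{+}$ (palindromic closure) denotes the shortest palindrome having $u$ as a prefix. Iterated palindromic closure $Pal$ is defined by $Pal(\varepsilon)=\varepsilon$ (where $\varepsilon$ is the empty word) and $Pal(vx)=(Pal(v)x)^{+}$ for any finite word $v$ and letter $x$. The Christoffel word of slope $p/q=[0;1+d_1,d_2,\dots,d_n,1]$ beginning with the letter $a$ is the word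 $a\,Pal(v)\,b$ with $v=a^{d_1}b^{d_2}a^{d_3}\cdots x^{d_n}$, where $x=a$ if $n$ is odd and $x=b$ if $n$ is even. It is the unique Lyndon word over $\{a,b\}$ of length $q$ containing $p$ occurrences of $b$ that is a factor of some infinite Sturmian word. For example, the Christoffel word of slope $2/5=[0;2,1,1]$ beginning with $a$ is $a\,Pal(ab)\,b=aabab$. *)

(* Defs.v *)
From mathcomp Require Import all_boot all_order all_algebra finmap.
From mathcomp Require Import boolp classical_sets functions cardinality.
Set Implicit Arguments. Unset Strict Implicit. Unset Printing Implicit Defensive.
Import Order.TTheory GRing.Theory Num.Theory.

(* The alphabet {a, b} is bool: its order is false < true, i.e. a < b. *)
Definition letter_a : bool := false.
Definition letter_b : bool := true.
Definition word := seq bool.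

Definition primitive (w : word) : Prop :=
  w <> [::] /\
  ~ exists x : word, exists k : nat,
      [/\ 2 <= k, size x < size w & w = flatten (nseq k x)].

Definition conjugate (u v : word) : Prop :=
  exists x y : word, u = x ++ y /\ v = y ++ x.

(* [seqlexi bool] is [seq bool] with the lexicographic order. *)
Definition lyndon (w : word) : Prop :=
  primitive w /\
  forall v : word, conjugate w v -> ((w : seqlexi bool) <= (v : seqlexi bool))%O.

Definition lyndon_factors (w : word) : set word :=
  [set z | infix z w /\ lyndon z]%classic.

(* fset_set maps infinite sets to the empty set; lyndon_factors w is always
   finite (finite_lyndon_factors), so this is the true cardinality. *)
Definition nb_lyndon_factors (w : word) : nat :=
  #|` fset_set (lyndon_factors w) |.

Definition palindrome (w : word) : Prop := rev w = w.

Definition is_pal_closure (u p : word) : Prop :=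
  [/\ prefix u p, palindrome p &
      forall p' : word, prefix u p' -> palindrome p' -> size p <= size p'].

(* Choice of the shortest palindrome with prefix u: it exists and is unique
   (pal_closureP, is_pal_closure_uniq), so the default [::] is never used. *)
Definition pal_closure (u : word) : word :=
  xget [::] [set p | is_pal_closure u p]%classic.

Definition Pal (v : word) : word :=
  foldl (fun (p : word) (x : bool) => pal_closure (rcons p x)) [::] v.

(* cfrac [:: c_1; ...; c_k] = [0; c_1, ..., c_k] *)
Fixpoint cfrac (c : seq nat) : rat :=
  if c is c1 :: c' then ((c1%:R + cfrac c')^-1)%R else 0%R.

(* For d = [:: d_1; ...; d_n]: n >= 1, d_i >= 1 for i >= 2, and
   p / q = [0; 1 + d_1, d_2, ..., d_n, 1] (incr_nth d 0 adds 1 to d_1). *)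
Definition slope_expansion (p q : nat) (d : seq nat) : Prop :=
  [/\ 1 <= size d, all (leq 1) (behead d) &
      (p%:R / q%:R)%R = cfrac (rcons (incr_nth d 0) 1)].

(* a^{d_1} b^{d_2} a^{d_3} ...: the 0-based index i is even for blocks of a *)
Definition directive_word (d : seq nat) : word :=
  flatten [seq nseq (nth 0 d i) (if odd i then letter_b else letter_a)
          | i <- iota 0 (size d)].

(* The Christoffel word of slope p / q beginning with a; an expansion d as in
   slope_expansion is unique when it exists, so w is determined by p and q. *)
Definition christoffel_word (p q : nat) (w : word) : Prop :=
  exists2 d : seq nat, slope_expansion p q d &
    w = letter_a :: rcons (Pal (directive_word d)) letter_b.

Lemma finite_lyndon_factors (w : word) : finite_set (lyndon_factors w).
Proof.
apply: (@sub_finite_set _ _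
  [set` [seq take j (drop i w) | i <- iota 0 (size w).+1,
                                 j <- iota 0 (size w).+1]]%classic);
  last exact: finite_seq.
move=> z [/infixP [s1 [s2 ->]] _]; apply/allpairsP.
exists (size s1, size z); split; last 1 first.
- by rewrite /= drop_size_cat // take_size_cat.
- by rewrite mem_iota /= add0n ltnS !size_cat leq_addr.
- by rewrite mem_iota /= add0n ltnS !size_cat addnCA leq_addr.
Qed.

Lemma pal_closureP (u : word) : is_pal_closure u (pal_closure u).
Proof.
apply: (@xgetPex _ [::] [set p | is_pal_closure u p]%classic).
pose P n := `[< exists p, [/\ prefix u p, palindrome p & size p = n] >].
have exP : exists n, P n.
  exists (size (u ++ rev u)); apply/asboolP; exists (u ++ rev u).
  by split; rewrite ?prefix_prefix // /palindrome rev_cat revK.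
case: (ex_minnP exP) => n /asboolP [p [up pp <-]] minp.
exists p; split=> // p' up' pp'; apply: minp.
by apply/asboolP; exists p'.
Qed.

Lemma is_pal_closure_uniq (u p p' : word) :
  is_pal_closure u p -> is_pal_closure u p' -> p = p'.
Proof.
have form r : is_pal_closure u r -> r = u ++ rev (take (size r - size u) u).
  move=> [/prefixP [s ->] pal mins].
  have le_s : size s <= size u.
    have := mins (u ++ rev u) (prefix_prefix _ _).
    rewrite !size_cat size_rev leq_add2l; apply.
    by rewrite /palindrome rev_cat revK.
  rewrite size_cat addKn; congr (_ ++ _).
  have := congr1 (take (size s)) pal.
  by rewrite rev_cat take_size_cat ?size_rev // takel_cat // => <-; rewrite revK.
move=> cp cp'; rewrite (form p) // (form p') //.
case: cp cp' => [up palp minp] [up' palp' minp'].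
suff -> : size p = size p' by [].
by apply/eqP; rewrite eqn_leq minp // minp'.
Qed.

Lemma Pal_nil : Pal [::] = [::].
Proof. by []. Qed.

Lemma Pal_rcons (v : word) (x : bool) :
  Pal (rcons v x) = pal_closure (rcons (Pal v) x).
Proof. by rewrite /Pal foldl_rcons. Qed.

(* Main.v *)
Require Import Defs.
From mathcomp Require Import all_boot.
From mathcomp Require Import order ssralg ssrnum rat finmap zify lra.
From mathcomp Require Import boolp classical_sets cardinality.

Set Implicit Arguments. Unset Strict Implicit. Unset Printing Implicit Defensive.
Import Order.TTheory GRing.Theory Num.Theory.

(** Write [C v] for the word [a Pal(v) b].  The count is [size v + 3] for every
    word [v] whatsoever, by induction on [v] with the first letter removed.

    Justin's formula [Pal (x v) = psi_x (Pal v) x], where [psi_x] fixes [x] and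
    sends the other letter [y] to [x y], turns the Christoffel word [C (x v)]
    into the image of [C v] under a Lyndon morphism: [a -> a, b -> ab] if [x]
    is [a], and [a -> ab, b -> b] if [x] is [b] ([christoffel_cons]).  Both
    morphisms have the form [phi c]: the letter [c] is sent to [ab], the other
    letter is fixed.

    A morphism [phi c] preserves and reflects the lexicographic order, hence
    also the property of being a Lyndon word ([lyndon_phi]).  A Lyndon word of
    length at least 2 starts with [a] and ends with [b], so that a Lyndon
    factor of [phi c w] of that length cannot start or end in the middle of a
    block [ab]: it is the image of a factor of [w].  The fixed letter is the
    image of itself, and the letter [c] is not an image.  Hence [phi c w] has
    exactly one more Lyndon factor than [w] as soon as [w] contains both
    letters ([lyndon_factors_phi]).  The induction starts with [C [::] = ab],
    which has the three Lyndon factors [a], [b], [ab].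

    Finally [size v] is [sumn d] for the directive word [v] of [d], and the
    slope determines [d] since a continued fraction with positive quotients is
    determined by its value once its last quotient is required to be 1. *)

(** * Palindromic closure and Justin's formula *)

Lemma pal_closure_eq (u p : word) : is_pal_closure u p -> pal_closure u = p.
Proof. by move=> up; exact: is_pal_closure_uniq (pal_closureP u) up. Qed.

Lemma pal_closure_palindrome (u : word) : palindrome u -> pal_closure u = u.
Proof.
move=> pu; apply: pal_closure_eq; split=> // [|p' /size_prefix //].
exact: prefix_refl.
Qed.

(** A palindrome strictly extending [x :: s] has the form [x r x], with [r] a
    palindrome that extends [s].  Together with [pal_closure_palindrome] this
    computes the closure by recursion on the word, so that later proofs never
    speak of minimal length. *)
Lemma pal_closure_cons (x : bool) (s : word) :
  ~ palindrome (x :: s) ->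
  pal_closure (x :: s) = x :: rcons (pal_closure s) x.
Proof.
move=> npal; have [sp pp minp] := pal_closureP s.
apply: pal_closure_eq; split.
- rewrite /= eqxx /= -cats1; exact: prefix_trans sp (prefix_prefix _ _).
- by rewrite /palindrome rev_cons rev_rcons pp.
move=> [|y q] //= /andP[/eqP <-{y} sq] pq.
case/lastP: q sq pq => [|q y]; first by rewrite prefixs0 => /eqP es; case: npal; rewrite es.
move=> sq; rewrite /palindrome rev_cons rev_rcons rcons_cons.
move=> -[yx /rcons_inj[pq _]].
rewrite {y}yx in sq *.
have {}sq : prefix s q.
  move: sq; rewrite prefixE => /eqP sq.
  have [le_s|lt_s] := leqP (size s) (size q).
    by rewrite prefixE; move: sq; rewrite -cats1 takel_cat // => ->.
  case: npal; move: sq; rewrite take_oversize ?size_rcons // => <-.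
  by rewrite /palindrome rev_cons rev_rcons pq.
by rewrite !ltnS !size_rcons ltnS; apply: minp.
Qed.

Lemma palindrome_cons_rcons (x : bool) (s : word) :
  palindrome (x :: rcons s x) <-> palindrome s.
Proof.
rewrite /palindrome rev_cons rev_rcons rcons_cons.
by split=> [[/rcons_inj[]]|->].
Qed.

Lemma palindrome_cons_rcons_eq (x y : bool) (s : word) :
  palindrome (x :: rcons s y) -> x = y.
Proof. by rewrite /palindrome rev_cons rev_rcons rcons_cons => -[]. Qed.

(** Justin's morphism, which fixes [x] and prefixes the other letter with
    [x]. *)
Definition psi (x : bool) (w : word) : word :=
  flatten [seq if y == x then [:: x] else [:: x; y] | y <- w].

Lemma psi_cat x u v : psi x (u ++ v) = psi x u ++ psi x v.
Proof. by rewrite /psi map_cat flatten_cat. Qed.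

Lemma psi_cons_same x u : psi x (x :: u) = x :: psi x u.
Proof. by rewrite /psi /= eqxx. Qed.

Lemma psi_cons_other x u : psi x (~~ x :: u) = [:: x, ~~ x & psi x u].
Proof. by rewrite /psi /=; case: x. Qed.

Definition psi_consE := (psi_cons_same, psi_cons_other).

Lemma psi_rcons_same x u : psi x (rcons u x) = rcons (psi x u) x.
Proof. by rewrite -!cats1 psi_cat psi_cons_same. Qed.

Lemma psi_rcons_other x u :
  psi x (rcons u (~~ x)) = rcons (rcons (psi x u) x) (~~ x).
Proof. by rewrite -!cats1 psi_cat psi_cons_other -catA. Qed.

Definition psi_rconsE := (psi_rcons_same, psi_rcons_other).

Lemma letter_case (x y : bool) : y = x \/ y = ~~ x.
Proof. by case: x; case: y; [left|right|right|left]. Qed.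

Lemma psi_inj x : injective (psi x).
Proof.
elim=> [|y u IH] [|z v] //.
- by case: (letter_case x z) => ->; rewrite psi_consE.
- by case: (letter_case x y) => ->; rewrite psi_consE.
have psi_head w s : psi x w <> ~~ x :: s.
  by case: w => // t w; case: (letter_case x t) => ->; rewrite psi_consE;
    case: (x).
case: (letter_case x y) => ->; case: (letter_case x z) => ->; rewrite !psi_consE.
- by move=> [/IH ->].
- by move=> [/psi_head].
- by move=> [/esym/psi_head].
- by move=> [/IH ->].
Qed.

Lemma rev_psi_rcons x u : rev (rcons (psi x u) x) = rcons (psi x (rev u)) x.
Proof.
elim: u => [|y u IH] //; rewrite rev_cons.
case: (letter_case x y) => ->; rewrite psi_consE psi_rconsE;
  by rewrite ?rcons_cons !rev_cons IH.
Qed.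

Lemma palindrome_psi x u : palindrome (rcons (psi x u) x) <-> palindrome u.
Proof.
rewrite /palindrome rev_psi_rcons.
by split=> [/rcons_inj[/psi_inj]|->].
Qed.

(** Adding the final [x] makes the image symmetric: [psi x u] followed by [x]
    is a palindrome exactly when [u] is.  The recursions that compute the two
    closures therefore stop at the same point. *)
Lemma pal_closure_psi x u :
  pal_closure (rcons (psi x u) x) = rcons (psi x (pal_closure u)) x.
Proof.
elim: u => [|y u IH]; first by rewrite !pal_closure_palindrome.
have [pyu|npyu] := pselect (palindrome (y :: u)).
  by rewrite !pal_closure_palindrome //; apply/palindrome_psi.
have := npyu; rewrite (pal_closure_cons npyu) -(palindrome_psi x).
case: (letter_case x y) => -> npal; move: npal; rewrite !psi_consE psi_rconsE !rcons_cons.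
  by move=> npal; rewrite pal_closure_cons // IH.
move=> npal; rewrite pal_closure_cons // pal_closure_cons ?IH ?rcons_cons //.
by move/palindrome_cons_rcons_eq; case: (x).
Qed.

(** A palindrome that extends [psi x u] followed by [x y], with [y] the other
    letter, must go on with an [x]: nothing is lost by adding it at once,
    which brings the word into the form of [pal_closure_psi]. *)
Lemma pal_closure_psi_other x u :
  pal_closure (psi x (rcons u (~~ x))) =
  pal_closure (rcons (psi x (rcons u (~~ x))) x).
Proof.
have neq : x <> ~~ x by case: x.
elim: u => [|y u IH].
  rewrite /= psi_cons_other /=.
  rewrite pal_closure_cons; last by case: x neq.
  by rewrite !pal_closure_palindrome //; case: x neq.
rewrite rcons_cons; case: (letter_case x y) => ->; rewrite psi_consE.
  rewrite [LHS]pal_closure_cons; last first.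
    by rewrite psi_rconsE => /palindrome_cons_rcons_eq.
  rewrite IH rcons_cons [RHS]pal_closure_cons //.
  rewrite -rcons_cons -psi_cons_same => /palindrome_psi.
  by move/palindrome_cons_rcons_eq.
rewrite [LHS]pal_closure_cons; last first.
  by rewrite psi_rconsE -rcons_cons => /palindrome_cons_rcons_eq.
rewrite !rcons_cons.
have [pal|npal] := pselect (palindrome (~~ x :: psi x (rcons u (~~ x)))).
  rewrite (pal_closure_palindrome pal) [RHS]pal_closure_palindrome //.
  by rewrite -rcons_cons; apply/palindrome_cons_rcons.
rewrite [RHS]pal_closure_cons; last first.
  by rewrite -rcons_cons => /palindrome_cons_rcons.
rewrite [in RHS]pal_closure_cons; last first.
  by move/palindrome_cons_rcons_eq/esym.
by rewrite pal_closure_cons // IH.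
Qed.

Lemma Pal_cons x v : Pal (x :: v) = rcons (psi x (Pal v)) x.
Proof.
elim/last_ind: v => [|v y IH].
  by rewrite -[[:: x]]/(rcons [::] x) Pal_rcons pal_closure_palindrome.
rewrite -rcons_cons !Pal_rcons IH -pal_closure_psi.
by case: (letter_case x y) => ->; rewrite -?pal_closure_psi_other psi_rconsE.
Qed.

(** * The Lyndon morphisms and Christoffel words *)

Notation christoffel v := (letter_a :: rcons (Pal v) letter_b).

(** [phi letter_b] is [a -> a, b -> ab] and [phi letter_a] is
    [a -> ab, b -> b]. *)
Definition phi (c : bool) (w : word) : word :=
  flatten [seq if y == c then [:: letter_a; letter_b] else [:: y] | y <- w].

Lemma phi_cat c u v : phi c (u ++ v) = phi c u ++ phi c v.
Proof. by rewrite /phi map_cat flatten_cat. Qed.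

Lemma phi_cons c y u :
  phi c (y :: u) =
  if y == c then [:: letter_a, letter_b & phi c u] else y :: phi c u.
Proof. by rewrite /phi /=; case: ifP. Qed.

Lemma phi_neq0 c u : u <> [::] -> phi c u <> [::].
Proof. by case: u => // y u _; rewrite phi_cons; case: ifP. Qed.

Lemma psi_phi_a u : psi letter_a u = phi letter_b u.
Proof. by elim: u => [|[] u IH] //; rewrite phi_cons -IH. Qed.

Lemma psi_phi_b u : rcons (psi letter_b u) letter_b = letter_b :: phi letter_a u.
Proof.
elim: u => [|[] u IH] //.
  by rewrite psi_cons_same phi_cons rcons_cons IH.
by rewrite (psi_cons_other letter_b) phi_cons !rcons_cons IH.
Qed.

(** For [x = b] Justin's formula yields the blocks [b] and [ba]; moving one [b]
    from the end to the front turns them into the blocks [b] and [ab] of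
    [phi letter_a]. *)
Lemma christoffel_cons x v : christoffel (x :: v) = phi (~~ x) (christoffel v).
Proof.
rewrite Pal_cons -cats1 phi_cons; case: x => /=.
  by rewrite psi_phi_b -[X in _ = [:: _, _ & phi _ X]]cats1 phi_cat.
by rewrite psi_phi_a -[in RHS]cats1 phi_cat cat_rcons.
Qed.

(** A cut inside a block is recognised by the letters next to it: [a] on its
    left and [b] on its right. *)
Lemma phi_cut c w s t : phi c w = s ++ t ->
  (exists u v, [/\ w = u ++ v, s = phi c u & t = phi c v]) \/
  (exists u v, [/\ w = u ++ c :: v, s = rcons (phi c u) letter_a
                 & t = letter_b :: phi c v]).
Proof.
elim: w s => [|y w IH] s.
  by case: s => //= <-; left; exists [::], [::].
case: s => [|x s]; first by rewrite cat0s => <-; left; exists [::], (y :: w).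
rewrite phi_cons; case: eqP => [->|/eqP/negbTE yc].
  case=> <-; case: s => /= [<-|x' s [<- /IH]]; first by right; exists [::], w.
  case=> -[u [v [-> -> ->]]]; [left|right]; exists (c :: u), v;
    by split; rewrite ?phi_cons ?eqxx.
case=> <- /IH.
case=> -[u [v [-> -> ->]]]; [left|right]; exists (y :: u), v;
  by split; rewrite ?phi_cons ?yc.
Qed.

Notation lex_le u v := ((u : seqlexi bool) <= (v : seqlexi bool))%O.
Notation lex_lt u v := ((u : seqlexi bool) < (v : seqlexi bool))%O.

Lemma lex_le_cons (x y : bool) (u v : word) :
  lex_le (x :: u) (y :: v) = if x == y then lex_le u v else y.
Proof. by rewrite lexi_cons; case: x; case: y. Qed.

(** Where two words first differ, their images by [phi letter_a] already
    differ in the same direction, and those by [phi letter_b] one letter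
    later: an image by [phi letter_b] is empty or starts with [a], hence lies
    below every word that starts with [b]. *)
Lemma phi_le c u v : lex_le (phi c u) (phi c v) = lex_le u v.
Proof.
have phi_b_le w t : lex_le (phi letter_b w) (letter_b :: t).
  by case: w => [|[] w] //; rewrite phi_cons lex_le_cons.
have phi_b_ge w t : lex_le (letter_b :: t) (phi letter_b w) = false.
  by case: w => [|[] w] //; rewrite phi_cons lex_le_cons.
elim: u v => [|x u IH] [|y v] //; first by rewrite phi_cons; case: ifP.
rewrite !phi_cons lex_le_cons -IH.
by case: c x y {IH} phi_b_le phi_b_ge => -[] [] /= le ge;
  rewrite !lex_le_cons /= ?le ?ge.
Qed.

Lemma phi_lt c u v : lex_lt (phi c u) (phi c v) = lex_lt u v.
Proof. by rewrite !ltNge phi_le. Qed.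

Lemma phi_inj c : injective (phi c).
Proof.
move=> u v e; apply: (@le_anti _ (seqlexi bool)).
by rewrite -(phi_le c u v) -(phi_le c v u) e lexx.
Qed.

(** * Lyndon words *)

Lemma commuting_powers (u v : word) : u ++ v = v ++ u ->
  exists x i j, u = flatten (nseq i x) /\ v = flatten (nseq j x).
Proof.
have [n] := ubnP (size u + size v); elim: n u v => // n IH u v lt_n e.
wlog le_uv : u v lt_n e / size u <= size v.
  move=> H; case: (leqP (size u) (size v)) => [|/ltnW] le; first exact: H.
  have [||x [i [j [-> ->]]]] := H v u _ _ le => //; first by rewrite addnC.
  by exists x, j, i.
case: u lt_n e le_uv => [|a u] lt_n e le_uv.
  by exists v, 0, 1; rewrite /= cats0.
have [v' def_v] : exists v', v = (a :: u) ++ v'.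
  exists (drop (size (a :: u)) v).
  have := congr1 (take (size (a :: u))) e.
  by rewrite take_size_cat // takel_cat // => {1}->; rewrite cat_take_drop.
have [||x [i [j [eu ev]]]] := IH (a :: u) v'.
- by move: lt_n; rewrite def_v size_cat /=; lia.
- by move: e; rewrite def_v -catA => /eqP; rewrite eqseq_cat // eqxx => /eqP.
by exists x, i, (i + j); rewrite nseqD flatten_cat -eu -ev.
Qed.

(** Strictness of the comparison with the other conjugates accounts for
    primitivity: a word equal to a proper conjugate of itself is a product of
    two commuting words, hence a power. *)
Lemma lyndonP (w : word) : lyndon w <->
  w <> [::] /\
  forall u v, u <> [::] -> v <> [::] -> w = u ++ v -> lex_lt w (v ++ u).
Proof.
split=> [[[w0 prim] minw]|[w0 ltw]].
  split=> // u v u0 v0 def_w.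
  have := minw (v ++ u) (ex_intro _ u (ex_intro _ v (conj def_w erefl))).
  rewrite le_eqVlt => /predU1P[e|//]; case: prim.
  have [|x [i [j [eu ev]]]] := @commuting_powers u v; first by rewrite -def_w.
  have i0 : 0 < i by case: i eu.
  have j0 : 0 < j by case: j ev.
  have x0 : 0 < size x.
    by case: x eu {ev} => // eu; case: u0; rewrite eu; elim: (i).
  have def_wx : w = flatten (nseq (i + j) x).
    by rewrite nseqD flatten_cat -eu -ev.
  exists x, (i + j); split=> //; first by lia.
  rewrite def_wx size_flatten /shape map_nseq sumn_nseq.
  by rewrite -[ltnLHS]muln1 ltn_pmul2l //; lia.
split; first split=> //.
  move=> [x [k [k2 _ def_w]]]; case: k k2 def_w => [|[|k]] // _ def_w.
  have x0 : x <> [::] by move=> e; case: w0; rewrite def_w e; elim: (k).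
  have := ltw x (flatten (nseq k.+1 x)) x0.
  have -> : flatten (nseq k.+1 x) ++ x = w.
    rewrite def_w -[X in _ ++ X]cats0.
    rewrite -[x ++ [::]]/(flatten (nseq 1 x)) -flatten_cat -nseqD addn1.
    by [].
  rewrite ltxx => H; suff: false by [].
  by apply: H => //; case: (x) x0.
move=> v [x [y [def_w ->]]].
case: x def_w => [|a x] def_w; first by rewrite cats0 def_w.
case: y def_w => [|b y] def_w; first by rewrite def_w cats0.
exact/ltW/ltw.
Qed.

Lemma lyndon_letter (x : bool) : lyndon [:: x].
Proof. by apply/lyndonP; split=> // -[|y [|z u]] [|t v]. Qed.

Lemma rotate_a_le (u : word) : lex_le (letter_a :: u) (rcons u letter_a).
Proof. by elim: u => // -[] u IH; rewrite rcons_cons lex_le_cons. Qed.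

Lemma rotate_b_ge (u : word) : lex_le (rcons u letter_b) (letter_b :: u).
Proof. by elim: u => // -[] u IH; rewrite rcons_cons lex_le_cons. Qed.

(** Otherwise, moving the first letter to the end or the last letter to the
    front would give a smaller or equal conjugate. *)
Lemma lyndon_ends (w : word) : lyndon w ->
  (exists x, w = [:: x]) \/ (exists u, w = letter_a :: rcons u letter_b).
Proof.
move=> /lyndonP[]; case: w => // x w _; case/lastP: w => [|u y] ltw.
  by left; exists x.
right; exists u; case: x ltw => ltw.
  have := ltw [:: true] (rcons u y); rewrite cats1 ltNge rotate_b_ge.
  by move=> H; suff: false by []; apply: H => //; case: (u).
case: y ltw => // ltw.
have := ltw (false :: u) [:: false]; rewrite cats1 ltNge rotate_a_le.
by move=> H; suff: false by []; apply: H.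
Qed.

Lemma lyndon_phi c w : lyndon (phi c w) <-> lyndon w.
Proof.
rewrite !lyndonP; split=> -[w0 ltw]; split.
- by move=> e; rewrite e in w0.
- move=> u v u0 v0 def_w; rewrite -(phi_lt c) phi_cat.
  by apply: ltw; rewrite -?phi_cat ?def_w //; apply: phi_neq0.
- exact: phi_neq0.
move=> s t s0 t0 def_st; case: (phi_cut def_st) => -[u [v [def_w es et]]].
  rewrite es et -phi_cat phi_lt; apply: ltw => // e.
    by case: s0; rewrite es e.
  by case: t0; rewrite et e.
(* The cut falls inside a block: the rotated word starts with b, whereas the
   word itself starts with a. *)
suff [r ->] : exists r, phi c w = letter_a :: r.
  by rewrite et cat_cons ltNge lex_le_cons.
case: u def_w es => [|x u] def_w es.
  by exists (letter_b :: phi c v); rewrite def_w phi_cons eqxx.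
case: c x def_w {es def_st et} => -[] def_w; rewrite def_w /= phi_cons /=;
  try by eexists.
have : lex_lt w ((false :: v) ++ (true :: u)) by exact: ltw.
by rewrite def_w !cat_cons ltNge lex_le_cons.
Qed.

(** * Counting Lyndon factors *)

Lemma infix_phi c u w : infix u w -> infix (phi c u) (phi c w).
Proof.
by case/infixP=> [s [t ->]]; rewrite !phi_cat; apply/infixP; exists (phi c s), (phi c t).
Qed.

Lemma infix_letter (x : bool) (w : word) : infix [:: x] w = (x \in w).
Proof.
apply/infixP/idP => [[s [t ->]]|/splitPr[s t]]; last by exists s, t.
by rewrite mem_cat /= inE eqxx orbT.
Qed.

(** Such a factor starts and ends at block boundaries, because a cut inside a
    block has [a] on its left and [b] on its right. *)
Lemma infix_phi_decode c (w u : word) :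
  infix (letter_a :: rcons u letter_b) (phi c w) ->
  exists2 y, infix y w & letter_a :: rcons u letter_b = phi c y.
Proof.
case/infixP=> [s [t e]].
case: (phi_cut e) => -[w1 [w2 [def_w _ e2]]] //.
case: (phi_cut (esym e2)) => -[y [w3 [def_w2 ez _]]].
  by exists y => //; apply/infixP; exists w1, w3; rewrite def_w def_w2.
by move: ez; rewrite -rcons_cons => /rcons_inj[].
Qed.

(** The other letter is the image of itself, so [c] is the only Lyndon factor
    that does not come from [w]. *)
Lemma lyndon_factors_phi c (w : word) : c \in w -> ~~ c \in w ->
  lyndon_factors (phi c w) =
  ([set [:: c]] `|` phi c @` lyndon_factors w)%classic.
Proof.
move=> cw ncw; have fix_other : phi c [:: ~~ c] = [:: ~~ c] by case: (c).
apply/seteqP; split=> z /=.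
  move=> [zw lz]; case: (lyndon_ends lz) => [[x ez]|[u ez]].
    case: (letter_case c x) ez => -> ->; [by left|right].
    by exists [:: ~~ c] => //; split; [rewrite infix_letter|exact: lyndon_letter].
  right; move: zw lz; rewrite ez => /infix_phi_decode[y yw ->] /lyndon_phi ly.
  by exists y.
move=> [->|[y [yw ly] <-]].
  split; last exact: lyndon_letter.
  have : infix (phi c [:: c]) (phi c w) by apply: infix_phi; rewrite infix_letter.
  apply: infix_trans.
  by rewrite infix_letter phi_cons eqxx; case: (c).
by split; [exact: infix_phi|apply/lyndon_phi].
Qed.

Lemma letter_not_phi c u : phi c u <> [:: c].
Proof. by case: u => // y u; rewrite phi_cons; case: eqP => // yc [/yc]. Qed.

Lemma nb_lyndon_factors_phi c (w : word) : c \in w -> ~~ c \in w ->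
  nb_lyndon_factors (phi c w) = (nb_lyndon_factors w).+1.
Proof.
move=> cw ncw; rewrite /nb_lyndon_factors lyndon_factors_phi //.
have finw := finite_lyndon_factors w.
rewrite fset_setU1 ?fset_set_image //; last exact: finite_image.
rewrite cardfsU1 card_imfset; last exact: phi_inj.
case: imfsetP => // -[y _ /esym /letter_not_phi //].
Qed.

Lemma lyndon_factors_ab :
  lyndon_factors [:: letter_a; letter_b] =
  [set` [fset z in [:: [:: letter_a]; [:: letter_b];
                       [:: letter_a; letter_b]]]%fset]%classic.
Proof.
have lab : lyndon [:: letter_a; letter_b].
  rewrite -[[:: _; _]]/(phi letter_b [:: letter_b]).
  by apply/lyndon_phi; exact: lyndon_letter.
apply/seteqP; split=> z /=.
  rewrite !inE => -[zab lz]; case: (lyndon_ends lz) => [[[] ->]|[u ez]] //.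
  have := size_infix zab; rewrite ez /= size_rcons.
  by case: u {ez}.
rewrite !inE orbF => /or3P[] /eqP ->; split=> //; exact: lyndon_letter.
Qed.

Lemma nb_lyndon_factors_christoffel (v : word) :
  nb_lyndon_factors (christoffel v) = size v + 3.
Proof.
elim: v => [|x v IH].
  by rewrite /nb_lyndon_factors Pal_nil lyndon_factors_ab set_fsetK card_fseq.
have a_in : letter_a \in christoffel v by rewrite inE eqxx.
have b_in : letter_b \in christoffel v by rewrite inE mem_rcons mem_head orbT.
rewrite christoffel_cons nb_lyndon_factors_phi ?IH //.
  by case: (x).
by rewrite negbK; case: (x).
Qed.

Lemma size_directive_word (d : seq nat) : size (directive_word d) = sumn d.
Proof.
rewrite size_flatten /shape -map_comp; congr sumn.
rewrite -[RHS](mkseq_nth 0 d) /mkseq; apply: eq_map => i /=.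
by rewrite size_nseq.
Qed.

(** * Uniqueness of the continued fraction *)

Section ContinuedFraction.
Local Open Scope ring_scope.

Lemma cfrac_gt0 (c : seq nat) : 0 < cfrac (rcons c 1%N).
Proof.
elim: c => [|x c IH] //=.
by rewrite invr_gt0 ltr_wpDl // ler0n.
Qed.

Lemma cfrac_lt1 (x : nat) (c : seq nat) : (0 < x)%N -> cfrac (rcons (x :: c) 1%N) < 1.
Proof.
move=> x0 /=; rewrite invf_lt1; last by rewrite ltr_wpDl ?cfrac_gt0 ?ler0n.
by rewrite ltr_pwDr ?cfrac_gt0 // ler1n.
Qed.

Lemma cfrac_le1 (c : seq nat) : all (leq 1) c -> cfrac (rcons c 1%N) <= 1.
Proof. by case: c => [|x c] //= /andP[x0 _]; apply/ltW/cfrac_lt1. Qed.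

(** Without the imposed last quotient 1 the expansion would not be unique,
    because [k + 1] and [k + 1 / 1] are equal. *)
Lemma cfrac_inj (c c' : seq nat) : all (leq 1) c -> all (leq 1) c' ->
  cfrac (rcons c 1%N) = cfrac (rcons c' 1%N) -> c = c'.
Proof.
elim: c c' => [|x c IH] [|y c'] //.
- by move=> _ /andP[y0 _] e; have := cfrac_lt1 c' y0; rewrite -e.
- by move=> /andP[x0 _] _ e; have := cfrac_lt1 c x0; rewrite e.
move=> /andP[_ c0] /andP[_ c0'] /= /invr_inj e.
(* Both fractional parts lie in ]0, 1], so the integers x and y are equal. *)
have lt_absurd (m n : nat) (r s : rat) :
    m%:R + r = n%:R + s -> r <= 1 -> 0 < s -> (m < n)%N -> False.
  move=> emn r1 s0; rewrite -(ler_nat rat) -natr1; lra.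
have exy : x = y.
  case: (ltngtP x y) => // lt; exfalso.
    exact: lt_absurd e (cfrac_le1 c0) (cfrac_gt0 c') lt.
  exact: lt_absurd (esym e) (cfrac_le1 c0') (cfrac_gt0 c) lt.
by move: e; rewrite exy => /addrI /(IH _ c0 c0') ->.
Qed.

End ContinuedFraction.

Lemma slope_expansion_uniq p q (d d' : seq nat) :
  slope_expansion p q d -> slope_expansion p q d' -> d = d'.
Proof.
case: d d' => [|x d] [|y d'] [] // _ d0 e [] // _ d0' e'.
have ec : x.+1 :: d = y.+1 :: d' by apply: cfrac_inj => //; rewrite -[LHS]e.
by case: ec => -> ->.
Qed.

Theorem theorem8 (p q : nat) (d : seq nat) (w : word) :
  coprime p q -> 0 < p -> p < q ->
  slope_expansion p q d ->
  christoffel_word p q w ->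
  nb_lyndon_factors w = sumn d + 3.
Proof.
move=> _ _ _ slope_d [d' slope_d' ->].
rewrite nb_lyndon_factors_christoffel size_directive_word.
by rewrite (slope_expansion_uniq slope_d slope_d').
Qed.
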